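(* Let $M^{2n}$ be a $2n$-dimensional manifold with a given smooth action $\theta$ of the torus $T^k$ with isolated fixed points, and let $c_\tau^1$ and $c_\tau^2$ be stable complex structures on $M^{2n}$ equivariant under $\theta$. Let $p$ be a fixed point. Then: (1) The weights $\Lambda_i^1(p)$ and $\Lambda_i^2(p)$, $1\le i\le n$, of the action $\theta$ at $p$ corresponding to the structures $c_\tau^1$ and $c_\tau^2$ are (when suitably ordered) related by $$\Lambda_i^2(p)=a_i(p)\,\Lambda_i^1(p),\qquad\text{where } a_i(p)=\pm1 .$$ (2) The signs $\mathrm{sign}(p)_1$ and $\mathrm{sign}(p)_2$ at $p$ corresponding to the structures $c_\tau^1$ and $c_\tau^2$ are related by $$\mathrm{sign}(p)_2=\epsilon\cdot\prod_{i=1}^n a_i(p)\cdot \mathrm{sign}(p)_1 ,$$ where $\epsilon=\pm1$ depending on whether $c_\tau^1$ and $c_\tau^2$ define the same orientation of $\tau(M^{2n})$ or not, and the $a_i(p)$ are such that $\Lambda_i^2(p)=a_i(p)\Lambda_i^1(p)$ for the weights of $\theta$ related to $c_\tau^1$ and $c_\tau^2$.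
   Context: A $\theta$-equivariant stable complex structure $c_\tau$ on $M^{2n}$ is a real vector bundle isomorphism $c_\tau:\tau(M^{2n})\oplus\mathbb{R}^{2(l-n)}\to\xi$ onto a complex vector bundle $\xi$ (for some $l$), where $\tau(M^{2n})$ is the tangent bundle, such that for every $t\in T^k$ the composition $r(t)=c_\tau\circ(d\theta(t)\oplus I)\circ c_\tau^{-1}:\xi\to\xi$ is a complex transformation. Giving $\mathbb{R}^{2(l-n)}$ its canonical orientation and $\xi$ the orientation from its complex structure, $c_\tau$ defines an orientation of $\tau(M^{2n})$. At an isolated fixed point $p$ the representation $r_p$ of $T^k$ on $\xi_p\cong\mathbb{C}^l$ splits as $\xi_p\cong\mathbb{C}^{n}\oplus\mathbb{C}^{l-n}$, where $T^k$ acts trivially on $\mathbb{C}^{l-n}$ and without trivial summands on $\mathbb{C}^n$. The representation on $\mathbb{C}^n$ is a sum of one-dimensional complex representations $r_{p,1}\oplus\dots\oplus r_{p,n}$, with $r_{p,j}(e^{2\pi i x_1},\dots,e^{2\pi i x_k})v=e^{2\pi i\langle\Lambda_j(p),\mathbf{x}\rangle}v$, $\Lambda_j(p)\in\mathbb{Z}^k$, $\mathbf{x}=(x_1,\dots,x_k)$; the $\Lambda_j(p)$ are the weights at $p$. The sign $\mathrm{sign}(p)$ is $+1$ if the composite $\tau_p(M^{2n})\xrightarrow{I\oplus 0}\tau_p(M^{2n})\oplus\mathbb{R}^{2(l-n)}\xrightarrow{c_{\tau,p}}\xi_p\cong\mathbb{C}^n\oplus\mathbb{C}^{l-n}\xrightarrow{\pi}\mathbb{C}^n$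 ($\pi$ the projection) preserves orientation, where $\tau_p(M^{2n})$ has the orientation defined by $c_\tau$ and $\mathbb{C}^n$ that of its complex structure; otherwise $\mathrm{sign}(p)=-1$.
   Formalization: For disconnected M, ε is read on the connected component of p: ε=+1 if the two structures define the same orientation of the tangent bundle over that component, otherwise −1; the global reading fails when the orientations agree on one component and differ on another. *)

(* Defs.v *)
From HB Require Import structures.
From mathcomp Require Import all_boot all_order all_algebra all_fingroup.
From mathcomp Require Import complex.
From mathcomp Require Import all_classical all_reals all_analysis.

Set Implicit Arguments.
Unset Strict Implicit.
Unset Printing Implicit Defensive.

Import Order.TTheory GRing.Theory Num.Theory.
Import numFieldNormedType.Exports.

Local Open Scope classical_set_scope.
Local Open Scope ring_scope.

(* [Ck_on r U f] is meant for an open set [U]. *)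
Fixpoint Ck_on (R : realType) (V W : normedModType R) (r : nat)
    (U : set V) (f : V -> W) {struct r} : Prop :=
  if r is r'.+1 then
    (forall x, U x -> differentiable f x) /\
    (forall v : V, Ck_on r' U ('D_v f))
  else {within U, continuous f}.

Definition smooth_on (R : realType) (V W : normedModType R)
    (U : set V) (f : V -> W) : Prop :=
  forall r, Ck_on r U f.

(* [chart_map] and [chart_inv] are total functions; only their restrictions to
   [chart_dom] and to its image are meaningful. *)
Record chart (R : realType) (M : topologicalType) (m : nat) := Chart {
  chart_dom : set M;
  chart_map :> M -> 'rV[R]_m;
  chart_inv : 'rV[R]_m -> M;
  chart_dom_open : open chart_dom;
  chart_img_open : open (chart_map @` chart_dom);
  chart_mapK : forall q, chart_dom q -> chart_inv (chart_map q) = q;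
  chart_map_continuous : {within chart_dom, continuous chart_map};
  chart_inv_continuous :
    {within chart_map @` chart_dom, continuous chart_inv} }.

(* A smooth manifold without boundary of dimension [m], not necessarily compact
   or connected. The atlas need not be maximal. [chart_at q] is a chosen chart
   around [q]; it only serves to name tangent vectors at [q]. *)
Record manifold (R : realType) (m : nat) := Manifold {
  manifold_space :> topologicalType;
  manifold_hausdorff : hausdorff_space manifold_space;
  manifold_countable : @second_countable manifold_space;
  atlas : set (chart R manifold_space m);
  atlas_smooth : forall a b, atlas a -> atlas b ->
    smooth_on (a @` (chart_dom a `&` chart_dom b)) (b \o chart_inv a);
  chart_at : manifold_space -> chart R manifold_space m;
  chart_at_atlas : forall q, atlas (chart_at q);
  chart_at_dom : forall q, chart_dom (chart_at q) q }.

(* The tangent space at [q] is identified with R^m through [chart_at q]: the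
   coordinates of the same vector in another chart [b] are obtained by applying
   the differential of [b \o chart_inv (chart_at q)]. *)
Definition tangent (R : realType) (m : nat) (M : manifold R m) (q : M) :
  normedModType R := 'rV[R]_m.

Definition tangent_map (R : realType) (m : nat) (M : manifold R m)
    (f : M -> M) (q : M) : tangent q -> tangent (f q) :=
  'd (fun y : 'rV[R]_m => chart_at (f q) (f (chart_inv (chart_at q) y)))
     (chart_at q q).

(* The tangent vector at [q] whose coordinates in the chart [b] are [u]; as [q]
   varies this is the local trivialization of the tangent bundle given by [b]. *)
Definition chart_tangent (R : realType) (m : nat) (M : manifold R m)
    (b : chart R M m) (q : M) : 'rV[R]_m -> tangent q :=
  'd (fun y : 'rV[R]_m => chart_at q (chart_inv b y)) (b q).

(* The coordinates (Re z_1, Im z_1, ..., Re z_r, Im z_r); they define both the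
   topology and the canonical orientation of C^r. *)
Definition real_coords (R : realType) (r : nat) (z : 'rV[R[i]]_r) :
    'rV[R]_(r * 2) :=
  mxvec (\matrix_(j < r, s < 2)
           if s == 0 then complex.Re (z 0 j) else complex.Im (z 0 j)).

(* Bundles and their isomorphisms are only required to be continuous, which
   covers the smooth ones. [triv i q] and [trivV i q] are only
   meaningful for [q] in [triv_dom i]. *)
Record complex_bundle (R : realType) (M : topologicalType) (r : nat) :=
  ComplexBundle {
  fibre :> M -> lmodType R[i];
  triv_index : Type;
  triv_dom : triv_index -> set M;
  triv : forall (i : triv_index) (q : M), {linear fibre q -> 'rV[R[i]]_r};
  trivV : forall (i : triv_index) (q : M), 'rV[R[i]]_r -> fibre q;
  triv_dom_open : forall i, open (triv_dom i);
  triv_cover : forall q, exists i, triv_dom i q;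
  trivK : forall i q, triv_dom i q -> cancel (triv i q) (trivV i q);
  trivVK : forall i q, triv_dom i q -> cancel (trivV i q) (triv i q);
  triv_continuous : forall i j (z : 'rV[R[i]]_r),
    {within triv_dom i `&` triv_dom j,
      continuous (fun q => real_coords (triv j q (trivV i q z)))} }.

(* A stable complex structure with [l = n + d]: a real vector bundle
   isomorphism from TM (+) R^(2d) onto a complex bundle of rank [n + d].
   Real-linearity is linearity along the embedding of R into R[i].
   [ctau_continuous] is continuity of the bundle map in local trivializations:
   the images of the vectors with constant coordinates vary continuously. *)
Record stable_complex_structure (R : realType) (n : nat)
    (M : manifold R (n * 2)) (d : nat) := StableComplexStructure {
  scs_bundle : complex_bundle R M (n + d);
  ctau : forall q : M,
    {linear (tangent q * 'rV[R]_(d * 2))%type -> scs_bundle q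
       | (@real_complex R) \; *:%R};
  ctauV : forall q : M, scs_bundle q -> tangent q * 'rV[R]_(d * 2);
  ctauK : forall q, cancel (@ctau q) (@ctauV q);
  ctauVK : forall q, cancel (@ctauV q) (@ctau q);
  ctau_continuous : forall (b : chart R M (n * 2)) (i : triv_index scs_bundle)
      (u : 'rV[R]_(n * 2)) (y : 'rV[R]_(d * 2)), atlas b ->
    {within chart_dom b `&` triv_dom i,
      continuous (fun q =>
        real_coords (triv i q (ctau q (chart_tangent b q u, y))))} }.

Definition circle (R : realType) : Type := {z : R[i] | `|z| == 1}.

Lemma circle1_subproof (R : realType) : `|1 : R[i]| == 1.
Proof. by rewrite normr1. Qed.

Lemma circle_mul_subproof (R : realType) (s t : circle R) :
  `|val s * val t| == 1.
Proof. by rewrite normrM (eqP (valP s)) (eqP (valP t)) mulr1. Qed.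

Lemma circle_exp_subproof (R : realType) (x : R) :
  `|Complex (cos (2 * pi * x)) (sin (2 * pi * x))| == 1.
Proof. by rewrite normc_def /= cos2Dsin2 sqrtr1. Qed.

Definition circle1 (R : realType) : circle R := exist _ 1 (circle1_subproof R).

Definition circle_mul (R : realType) (s t : circle R) : circle R :=
  exist _ (val s * val t) (circle_mul_subproof s t).

Definition circle_exp (R : realType) (x : R) : circle R :=
  exist _ (Complex (cos (2 * pi * x)) (sin (2 * pi * x)))
    (circle_exp_subproof x).

Definition torus (R : realType) (k : nat) : Type := 'I_k -> circle R.

Definition torus1 (R : realType) (k : nat) : torus R k := fun=> circle1 R.

Definition torus_mul (R : realType) (k : nat) (s t : torus R k) : torus R k :=
  fun j => circle_mul (s j) (t j).

Definition torus_exp (R : realType) (k : nat) (x : 'rV[R]_k) : torus R k :=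
  fun j => circle_exp (x 0 j).

(* Since [torus_exp] is a smooth covering R^k -> T^k whose local inverses are
   the charts of T^k, continuity and smoothness of the action
   T^k * M -> M are expressed on R^k * M. *)
Record torus_action (R : realType) (k m : nat) (M : manifold R m) :=
  TorusAction {
  act :> torus R k -> M -> M;
  act1 : forall q, act (@torus1 R k) q = q;
  actM : forall s t q, act (torus_mul s t) q = act s (act t q);
  act_continuous :
    continuous (fun xq : 'rV[R]_k * M => act (torus_exp xq.1) xq.2);
  act_smooth : forall a b : chart R M m, atlas a -> atlas b ->
    smooth_on
      [set xy : 'rV[R]_k * 'rV[R]_m | (a @` chart_dom a) xy.2 /\
         chart_dom b (act (torus_exp xy.1) (chart_inv a xy.2))]
      (fun xy => b (act (torus_exp xy.1) (chart_inv a xy.2))) }.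

Definition fixed_points (R : realType) (k m : nat) (M : manifold R m)
    (theta : torus_action k M) : set M :=
  [set q | forall t, theta t q = q].

Definition has_isolated_fixed_points (R : realType) (k m : nat)
    (M : manifold R m) (theta : torus_action k M) : Prop :=
  fixed_points theta `<=` isolated (fixed_points theta).

(* r(t) = ctau o (d theta(t) (+) I) o ctau^-1 on the fibre over [q]. *)
Definition bundle_rep (R : realType) (k n d : nat) (M : manifold R (n * 2))
    (theta : torus_action k M) (c : stable_complex_structure M d)
    (t : torus R k) (q : M) (v : scs_bundle c q) :
    scs_bundle c (theta t q) :=
  let w := ctauV v in
  ctau c (theta t q) (tangent_map (theta t) w.1, w.2).

Definition equivariant (R : realType) (k n d : nat) (M : manifold R (n * 2))
    (theta : torus_action k M) (c : stable_complex_structure M d) : Prop :=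
  forall (t : torus R k) (q : M), linear (@bundle_rep R k n d M theta c t q).

(* The representation r_p at a fixed point: [bundle_rep] transported along
   [theta t p = p]. *)
Definition fixed_rep (R : realType) (k n d : nat) (M : manifold R (n * 2))
    (theta : torus_action k M) (c : stable_complex_structure M d)
    (p : M) (hp : fixed_points theta p) (t : torus R k) (v : scs_bundle c p) :
    scs_bundle c p :=
  eq_rect (theta t p) (fun q : M => scs_bundle c q : Type)
    (bundle_rep theta t v) p (hp t).

Definition pairing (R : realType) (k : nat) (L : 'rV[int]_k) (x : 'rV[R]_k) :
    R :=
  \sum_(j < k) (L 0 j)%:~R * x 0 j.

(* A splitting of r_p as r_{p,1} (+) ... (+) r_{p,n} on C^n (no trivial summand,
   i.e. nonzero weights) and the trivial representation on C^d. *)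
Record weight_splitting (R : realType) (k n d : nat) (M : manifold R (n * 2))
    (theta : torus_action k M) (c : stable_complex_structure M d)
    (p : M) (hp : fixed_points theta p) := WeightSplitting {
  split_iso : {linear scs_bundle c p -> ('rV[R[i]]_n * 'rV[R[i]]_d)%type};
  split_iso_bij : bijective split_iso;
  weight : 'I_n -> 'rV[int]_k;
  weight_neq0 : forall j, weight j != 0;
  split_rep : forall (x : 'rV[R]_k) (v : scs_bundle c p),
    split_iso (fixed_rep hp (torus_exp x) v) =
    (\row_j (val (circle_exp (pairing (weight j) x)) * (split_iso v).1 0 j),
     (split_iso v).2) }.

(* The real coordinates, in C^n (+) C^d, of the images under ctau of the rows of
   [e] (tangent vectors at [q]) followed by the canonical basis of R^(2d). *)
Definition stable_frame_mx (R : realType) (n d : nat) (M : manifold R (n * 2))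
    (c : stable_complex_structure M d) (q : M)
    (psi : scs_bundle c q -> 'rV[R[i]]_n * 'rV[R[i]]_d) (e : 'M[R]_(n * 2)) :
    'M[R]_(n * 2 + d * 2) :=
  let coords z := row_mx (real_coords (psi z).1) (real_coords (psi z).2) in
  col_mx (\matrix_(j < n * 2) coords (ctau c q (row j e, 0)))
         (\matrix_(j < d * 2) coords (ctau c q (0, delta_mx 0 j))).

(* Whether the basis of the tangent space at [q] formed by the rows of [e] is
   positive for the orientation defined by [c]. The complex isomorphism [psi] is
   immaterial. For [n = 0] the orientation of a point is the sign attached to
   its empty basis. *)
Definition positive_basis (R : realType) (n d : nat) (M : manifold R (n * 2))
    (c : stable_complex_structure M d) (q : M) (e : 'M[R]_(n * 2)) : Prop :=
  exists psi : {linear scs_bundle c q -> ('rV[R[i]]_n * 'rV[R[i]]_d)%type},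
    bijective psi /\ 0 < \det (stable_frame_mx psi e).

Definition same_orientation_at (R : realType) (n d1 d2 : nat)
    (M : manifold R (n * 2)) (c1 : stable_complex_structure M d1)
    (c2 : stable_complex_structure M d2) (q : M) : Prop :=
  forall e : 'M[R]_(n * 2), e \in unitmx ->
    (positive_basis c1 q e <-> positive_basis c2 q e).

(* [+1] if [c1] and [c2] define the same orientation of the tangent bundle over
   the connected component of [p] (over M itself when M is connected), and [-1]
   otherwise. *)
Definition orientation_sign (R : realType) (n d1 d2 : nat)
    (M : manifold R (n * 2)) (c1 : stable_complex_structure M d1)
    (c2 : stable_complex_structure M d2) (p : M) : int :=
  if `[< forall q, connected_component setT p q ->
           same_orientation_at c1 c2 q >]
  then 1 else -1.

(* The composite of I (+) 0, ctau and the projection onto C^n maps positive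
   bases to positive bases and negative ones to negative ones. *)
Definition preserves_orientation (R : realType) (k n d : nat)
    (M : manifold R (n * 2)) (theta : torus_action k M)
    (c : stable_complex_structure M d) (p : M) (hp : fixed_points theta p)
    (S : weight_splitting c hp) : Prop :=
  forall e : 'M[R]_(n * 2), e \in unitmx ->
    (positive_basis c p e <->
     0 < \det (\matrix_(j < n * 2)
                 real_coords (split_iso S (ctau c p (row j e, 0))).1)).

Definition fixed_point_sign (R : realType) (k n d : nat)
    (M : manifold R (n * 2)) (theta : torus_action k M)
    (c : stable_complex_structure M d) (p : M) (hp : fixed_points theta p)
    (S : weight_splitting c hp) : int :=
  if `[< preserves_orientation S >] then 1 else -1.

Definition weights_related (k n : nat) (L1 L2 : 'I_n -> 'rV[int]_k)
    (s : 'S_n) (a : 'I_n -> int) : Prop :=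
  forall i, (a i = 1 \/ a i = -1) /\ L2 (s i) = a i *: L1 i.

(* Main.v *)
(* At a fixed point, ctau carries T(+)R^(2d), with the torus acting trivially on
   R^(2d), to C^n(+)C^d, with nonzero weights on C^n only. Hence it maps R^(2d)
   onto the trivial summand C^d, and the T-block of ctau intertwines the
   isotropy representation with the rotations of C^n. The blocks of two
   structures differ by a real isomorphism Phi of C^n intertwining two
   rotations; at a generic small x in R^k:
   - Phi conjugates the matrices of cosines, so their characteristic polynomials
     agree, which matches the weights up to order and sign;
   - after conjugating the coordinates with negative sine, Phi commutes with
     multiplication by i and so has positive determinant. The sign of det Phi is
     therefore the product of the signs of all the sines, which is the product
     of the a_i.
   By block triangularity sign(p) is the sign of det F det F_TT, where F is the
   matrix of ctau and F_TT its T-block. The two structures define the same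
   orientation at q when the product of their frame determinants is positive.
   In local trivializations this product is continuous and nonvanishing, so
   whether they agree at q depends only on the connected component of q. *)
Require Import Defs.
From HB Require Import structures.
From mathcomp Require Import all_boot all_order all_algebra all_fingroup.
From mathcomp Require Import complex.
From mathcomp Require Import all_classical all_reals all_analysis.
From mathcomp Require Import ring lra.

Set Implicit Arguments.
Unset Strict Implicit.
Unset Printing Implicit Defensive.

Import Order.TTheory GRing.Theory Num.Theory.
Import numFieldNormedType.Exports.

Local Open Scope ring_scope.

(** * Real matrices commuting with a complex structure *)

Lemma mulmx_row_inj (F : pzSemiRingType) (m n : nat) (A B : 'M[F]_(m, n)) :
  (forall u : 'rV_m, u *m A = u *m B) -> A = B.
Proof. by move=> AB; apply/row_matrixP => i; rewrite !rowE AB. Qed.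

Lemma mul_split_idempotent (S : pzRingType) (P N : S) :
  P * P = P -> P * N = N * P -> (N * P + (1 - P)) * (P + N * (1 - P)) = N.
Proof.
move=> PP PN; set Q := 1 - P.
have PQ : P * Q = 0 by rewrite mulrBr mulr1 PP subrr.
have QP : Q * P = 0 by rewrite mulrBl mul1r PP subrr.
have QQ : Q * Q = Q by rewrite mulrBl mul1r PQ subr0.
have QN : Q * N = N * Q by rewrite mulrBl mulrBr PN mul1r mulr1.
have NPQ : N * P * (N * Q) = 0 by rewrite -mulrA (mulrA P) PN -mulrA PQ !mulr0.
have QNQ : Q * (N * Q) = N * Q by rewrite mulrA QN -mulrA QQ.
rewrite mulrDl (mulrDr (N * P)) (mulrDr Q) NPQ QP QNQ.
rewrite -(mulrA N P) PP addr0 add0r -mulrDr.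
by rewrite addrC subrK mulr1.
Qed.

(* With P = (1 - iJ)/2 and Q = 1 - P its conjugate, N = (N P + Q)(P + N Q) and
   the two factors are conjugate to each other. *)
Lemma det_comm_complex_structure (C : comNzRingType) (conj : {rmorphism C -> C})
    (i h : C) (m : nat) (J N : 'M[C]_m) :
    i * i = -1 -> conj i = - i -> 2 * h = 1 -> conj h = h ->
    map_mx conj J = J -> map_mx conj N = N ->
    J *m J = - 1%:M -> J *m N = N *m J ->
  exists z : C, \det N = z * conj z.
Proof.
move=> ii ci h2 ch cJ cN JJ JN.
pose P : 'M[C]_m := h *: (1%:M - i *: J).
have JJ2 : (1%:M - i *: J) *m (1%:M - i *: J) = 2 *: (1%:M - i *: J).
  rewrite mulmxBl !mulmxBr !mul1mx !mulmx1.
  rewrite -scalemxAl -scalemxAr scalerA ii JJ scaleN1r opprK.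
  by rewrite opprB scaler_nat mulr2n.
have PP : P *m P = P.
  rewrite /P -scalemxAl -scalemxAr JJ2 [X in _ *: X]scalerA.
  by rewrite [h * 2]mulrC h2 scale1r.
have PN : P *m N = N *m P.
  rewrite /P -scalemxAl -scalemxAr mulmxBl mulmxBr mul1mx mulmx1.
  by rewrite -scalemxAl -scalemxAr JN.
have cP : map_mx conj P = 1%:M - P.
  rewrite /P map_mxZ map_mxB map_mx1 map_mxZ cJ ch ci scaleNr opprK.
  apply/eqP; rewrite eq_sym subr_eq -scalerDr addrACA subrr addr0.
  by rewrite -mulr2n -scaler_nat scalerA mulrC h2 scale1r.
exists (\det (N *m P + (1%:M - P))).
rewrite -det_map_mx map_mxD map_mxM map_mxB map_mx1 cN cP subKr.
rewrite [N *m (_ - _) + _]addrC -det_mulmx.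
by congr (\det _); rewrite [RHS](mul_split_idempotent PP PN).
Qed.

Lemma det_comm_complex_structure_ge0 (R : rcfType) (m : nat) (J N : 'M[R]_m) :
  J *m J = - 1%:M -> J *m N = N *m J -> 0 <= \det N.
Proof.
move=> JJ JN.
pose toC (x : R) : R[i] := (x%:C)%C.
have conjt (A : 'M[R]_m) : map_mx conjc (map_mx toC A) = map_mx toC A.
  by apply/matrixP => i j; rewrite !mxE /= oppr0.
have [] := @det_comm_complex_structure R[i] conjc 'i%C 2^-1 m
  (map_mx toC J) (map_mx toC N) _ _ _ _ (conjt J) (conjt N).
- by rewrite -expr2 sqr_i.
- by apply/eqP; rewrite eq_complex /= oppr0 !eqxx.
- by rewrite mulfV // pnatr_eq0.
- by rewrite [LHS]conjc_inv (conjc_nat _ 2).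
- by rewrite -map_mxM JJ map_mxN map_mx1.
- by rewrite -!map_mxM JN.
case=> a b; rewrite det_map_mx => -[-> _].
by rewrite mulrN opprK -!expr2 addr_ge0 ?sqr_ge0.
Qed.

(** * Rotations of coordinate planes *)

Lemma mxvec_ind (R : Type) (m n : nat) (P : 'rV[R]_(m * n) -> Prop) :
  (forall A : 'M[R]_(m, n), P (mxvec A)) -> forall v, P v.
Proof. by move=> PA v; rewrite -(vec_mxK v). Qed.

Lemma mxvec_mul_diag (R : comPzRingType) (m n : nat) (A d : 'M[R]_(m, n)) :
  mxvec A *m diag_mx (mxvec d) = mxvec (\matrix_(i, j) (A i j * d i j)).
Proof.
rewrite mul_mx_diag; apply/rowP => k; rewrite !mxE.
by case/mxvec_indexP: k => i j; rewrite !mxvecE mxE.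
Qed.

Lemma det_diag_mxvec (R : comPzRingType) (m n : nat) (d : 'M[R]_(m, n)) :
  \det (diag_mx (mxvec d)) = \prod_i \prod_j d i j.
Proof.
rewrite det_diag pair_bigA (reindex _ (curry_mxvec_bij m n)) /=.
by apply: eq_bigr => -[i j] _; rewrite mxvecE.
Qed.

Lemma ord2P (P : 'I_2 -> Prop) : P 0 -> P 1 -> forall s, P s.
Proof.
by move=> P0 P1 [[|[|//]] hs]; [have -> : Ordinal hs = 0 by apply: val_inj|
  have -> : Ordinal hs = 1 by apply: val_inj].
Qed.

Section CoordinatePlanes.
Variables (R : rcfType) (n : nat).
Implicit Types (c s e : 'I_n -> R).

Definition imul_mx : 'M[R]_(n * 2) :=
  lin_mulmxr (\matrix_(s < 2, t < 2) if s == t then 0 else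
                if s == 0 then 1 else -1).

Definition plane_scale_mx c : 'M[R]_(n * 2) :=
  diag_mx (mxvec (\matrix_(j < n, s < 2) c j)).

Definition plane_reflect_mx e : 'M[R]_(n * 2) :=
  diag_mx (mxvec (\matrix_(j < n, s < 2) if s == 0 then 1 else e j)).

Definition rotation_mx c s := plane_scale_mx c + plane_scale_mx s *m imul_mx.

Lemma mxvec_imul (A : 'M[R]_(n, 2)) :
  mxvec A *m imul_mx =
  mxvec (\matrix_(j < n, s < 2) if s == 0 then - A j 1 else A j 0).
Proof.
rewrite mul_vec_lin /=; congr mxvec; apply/matrixP => j s.
rewrite !mxE !big_ord_recl big_ord0 !mxE addr0.
have -> : lift ord0 ord0 = 1 :> 'I_2 by apply: val_inj.
by move: s; apply: ord2P => /=; rewrite ?(mulr0, mulr1, mulrN1, add0r, addr0).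
Qed.

Lemma imul_mxK : imul_mx *m imul_mx = - 1%:M.
Proof.
apply: mulmx_row_inj; apply: mxvec_ind => A.
rewrite mulmxA !mxvec_imul mulmxN mulmx1 -linearN; congr mxvec.
by apply/matrixP => j; apply: ord2P; rewrite !mxE.
Qed.

Lemma plane_scale_mxM c e :
  plane_scale_mx c *m plane_scale_mx e = plane_scale_mx (fun j => c j * e j).
Proof.
apply: mulmx_row_inj; apply: mxvec_ind => A.
rewrite mulmxA !mxvec_mul_diag; congr mxvec.
by apply/matrixP => j s; rewrite !mxE mulrA.
Qed.

Lemma plane_scale_mx1 c : (forall j, c j = 1) -> plane_scale_mx c = 1%:M.
Proof.
move=> c1; apply: mulmx_row_inj; apply: mxvec_ind => A.
rewrite mxvec_mul_diag mulmx1; congr mxvec.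
by apply/matrixP => j s; rewrite !mxE c1 mulr1.
Qed.

Lemma imul_mx_scale c :
  imul_mx *m plane_scale_mx c = plane_scale_mx c *m imul_mx.
Proof.
apply: mulmx_row_inj; apply: mxvec_ind => A.
rewrite !mulmxA mxvec_imul !mxvec_mul_diag mxvec_imul; congr mxvec.
by apply/matrixP => j; apply: ord2P; rewrite !mxE //= mulNr.
Qed.

Lemma imul_mx_reflect e : (forall j, e j * e j = 1) ->
  imul_mx *m plane_reflect_mx e =
  plane_reflect_mx e *m imul_mx *m plane_scale_mx e.
Proof.
move=> e2; apply: mulmx_row_inj; apply: mxvec_ind => A.
rewrite !mulmxA mxvec_imul !mxvec_mul_diag mxvec_imul mxvec_mul_diag.
congr mxvec.
apply/matrixP => j; apply: ord2P; rewrite !mxE //= ?mulr1 //.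
by rewrite mulNr -mulrA e2 mulr1.
Qed.

Lemma plane_reflect_scale e c :
  plane_reflect_mx e *m plane_scale_mx c =
  plane_scale_mx c *m plane_reflect_mx e.
Proof. exact: diag_mxC. Qed.

Lemma det_plane_reflect e : \det (plane_reflect_mx e) = \prod_j e j.
Proof.
rewrite det_diag_mxvec; apply: eq_bigr => j _.
by rewrite !big_ord_recl big_ord0 !mxE /= mul1r mulr1.
Qed.

Lemma plane_scale_mxN c : plane_scale_mx (fun j => - c j) = - plane_scale_mx c.
Proof.
rewrite /plane_scale_mx -linearN -linearN; congr (diag_mx (mxvec _)).
by apply/matrixP => j s; rewrite !mxE.
Qed.

Lemma plane_scale_mxD c e :
  plane_scale_mx c + plane_scale_mx e = plane_scale_mx (fun j => c j + e j).
Proof.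
rewrite /plane_scale_mx -linearD -linearD; congr (diag_mx (mxvec _)).
by apply/matrixP => j s; rewrite !mxE.
Qed.

Lemma rotation_mxK c s : (forall j, c j ^+ 2 + s j ^+ 2 = 1) ->
  rotation_mx c s *m rotation_mx c (fun j => - s j) = 1%:M.
Proof.
move=> cs; rewrite /rotation_mx plane_scale_mxN.
set I := imul_mx; set C := plane_scale_mx c; set S := plane_scale_mx s.
have IS : I *m S = S *m I by exact: imul_mx_scale.
have IC : I *m C = C *m I by exact: imul_mx_scale.
rewrite mulNmx mulmxBr !mulmxDl -![S *m I *m _]mulmxA IC (mulmxA I) IS.
rewrite -[S *m I *m I]mulmxA imul_mxK !mulmxN mulmx1 opprD opprK.
rewrite !mulmxA (_ : S *m C = C *m S) ?addrA; last exact: diag_mxC.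
by rewrite addrK !plane_scale_mxM plane_scale_mxD plane_scale_mx1.
Qed.

Lemma rotation_mx_sum c s :
  rotation_mx c s + rotation_mx c (fun j => - s j) = 2 *: plane_scale_mx c.
Proof.
rewrite /rotation_mx plane_scale_mxN mulNmx addrACA subrr addr0.
by rewrite scaler_nat mulr2n.
Qed.

Lemma rotation_mx_fix (m : nat) c s (A : 'M[R]_(m, n * 2)) :
    (forall j, c j ^+ 2 + s j ^+ 2 = 1) -> (forall j, s j != 0) ->
  A *m rotation_mx c s = A -> A = 0.
Proof.
move=> cs s0 AD.
have AD' : A *m rotation_mx c (fun j => - s j) = A.
  by rewrite -[in LHS]AD -mulmxA rotation_mxK // mulmx1.
have : A *m (rotation_mx c s + rotation_mx c (fun j => - s j)) = A + A.
  by rewrite mulmxDr AD AD'.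
rewrite rotation_mx_sum -scalemxAr => AE.
apply/matrixP => i k; move/matrixP/(_ i k): AE.
rewrite mul_mx_diag !mxE; case/mxvec_indexP: k => j t; rewrite mxvecE mxE.
have c1 : c j != 1.
  apply: contra (s0 j) => /eqP c1; have := cs j; rewrite c1 expr1n => s2.
  by rewrite -sqrf_eq0; apply/eqP; lra.
move: (A i _) => a ac; have /eqP : a * (c j - 1) = 0 by lra.
by rewrite mulf_eq0 subr_eq0 (negPf c1) orbF => /eqP.
Qed.

Lemma diag_mx_intertwine (f : R -> R) (m : nat) (d1 : 'rV[R]_m) (d2 : 'rV[R]_m)
    (A : 'M[R]_m) :
  diag_mx d1 *m A = A *m diag_mx d2 ->
  diag_mx (map_mx f d1) *m A = A *m diag_mx (map_mx f d2).
Proof.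
rewrite !mul_mx_diag !mul_diag_mx => /matrixP dA.
apply/matrixP => i j; move: (dA i j); rewrite !mxE.
have [->|A0] := eqVneq (A i j) 0; first by rewrite !mulr0 !mul0r.
by rewrite [X in _ = X -> _]mulrC => /(mulIf A0) ->; rewrite mulrC.
Qed.

Section Intertwiner.
Variables (c1 s1 c2 s2 : 'I_n -> R) (Phi : 'M[R]_(n * 2)).
Hypotheses (cs1 : forall j, c1 j ^+ 2 + s1 j ^+ 2 = 1)
  (cs2 : forall j, c2 j ^+ 2 + s2 j ^+ 2 = 1).
Hypotheses (s1_neq0 : forall j, s1 j != 0) (s2_neq0 : forall j, s2 j != 0).
Hypothesis PhiE : rotation_mx c1 s1 *m Phi = Phi *m rotation_mx c2 s2.
Hypothesis Phi_unit : Phi \in unitmx.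

Let PhiE' : rotation_mx c1 (fun j => - s1 j) *m Phi =
            Phi *m rotation_mx c2 (fun j => - s2 j).
Proof.
rewrite -[LHS]mulmx1 -(rotation_mxK cs2) mulmxA -[_ *m Phi *m _]mulmxA -PhiE.
rewrite (mulmxA _ _ Phi).
have -> : rotation_mx c1 (fun j => - s1 j) *m rotation_mx c1 s1 = 1%:M.
  by apply: mulmx1C; exact: rotation_mxK.
by rewrite mul1mx.
Qed.

Lemma plane_scale_intertwine :
  plane_scale_mx c1 *m Phi = Phi *m plane_scale_mx c2.
Proof.
have : (rotation_mx c1 s1 + rotation_mx c1 (fun j => - s1 j)) *m Phi =
       Phi *m (rotation_mx c2 s2 + rotation_mx c2 (fun j => - s2 j)).
  by rewrite mulmxDl mulmxDr PhiE PhiE'.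
rewrite !rotation_mx_sum -scalemxAl -scalemxAr; apply: scalerI.
by rewrite pnatr_eq0.
Qed.

Lemma plane_scale_imul_intertwine :
  plane_scale_mx s1 *m imul_mx *m Phi = Phi *m (plane_scale_mx s2 *m imul_mx).
Proof.
move: PhiE; rewrite /rotation_mx mulmxDl mulmxDr plane_scale_intertwine.
by move/addrI.
Qed.

Lemma plane_scale_norm_intertwine :
  plane_scale_mx (fun j => `|s1 j|) *m Phi =
  Phi *m plane_scale_mx (fun j => `|s2 j|).
Proof.
have E c s : (forall j, c j ^+ 2 + s j ^+ 2 = 1) ->
    plane_scale_mx (fun j => `|s j|) =
    diag_mx (map_mx (fun x => Num.sqrt (1 - x ^+ 2))
               (mxvec (\matrix_(j < n, s < 2) c j))).
  move=> cs; rewrite map_mxvec; congr (diag_mx (mxvec _)).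
  by apply/matrixP => j t; rewrite !mxE -(cs j) addrAC subrr add0r sqrtr_sqr.
rewrite (E _ _ cs1) (E _ _ cs2); apply: diag_mx_intertwine.
exact: plane_scale_intertwine.
Qed.

(* Conjugating the coordinates rotated clockwise makes Phi complex linear. *)
Lemma det_intertwiner_gt0 :
  0 < (\prod_j Num.sg (s1 j)) * \det Phi * (\prod_j Num.sg (s2 j)).
Proof.
pose e1 j := Num.sg (s1 j); pose e2 j := Num.sg (s2 j).
have e1K j : e1 j * e1 j = 1 by rewrite -expr2 sqr_sg s1_neq0.
have e2K j : e2 j * e2 j = 1 by rewrite -expr2 sqr_sg s2_neq0.
rewrite -!det_plane_reflect -!det_mulmx lt0r; apply/andP; split.
  rewrite !det_mulmx !mulf_neq0 //; last first.
  - by rewrite det_plane_reflect; apply/prodf_neq0 => j _; rewrite sgr_eq0.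
  - by move: Phi_unit; rewrite unitmxE unitfE.
  - by rewrite det_plane_reflect; apply/prodf_neq0 => j _; rewrite sgr_eq0.
apply: (@det_comm_complex_structure_ge0 _ _ imul_mx); first exact: imul_mxK.
set K1 := plane_reflect_mx _; set K2 := plane_reflect_mx _.
pose E1 := plane_scale_mx e1; pose E2 := plane_scale_mx e2.
have EPhi : imul_mx *m E1 *m Phi = Phi *m imul_mx *m E2.
  pose N1 := plane_scale_mx (fun j => `|s1 j|).
  pose N2 := plane_scale_mx (fun j => `|s2 j|).
  pose V1 := plane_scale_mx (fun j => `|s1 j|^-1).
  have VN : V1 *m N1 = 1%:M.
    rewrite plane_scale_mxM plane_scale_mx1 // => j.
    by rewrite mulVf ?normr_eq0.
  have NE (s : 'I_n -> R) : plane_scale_mx (fun j => `|s j|) *m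
      plane_scale_mx (fun j => Num.sg (s j)) = plane_scale_mx s.
    rewrite plane_scale_mxM; congr (diag_mx (mxvec _)).
    by apply/matrixP => j t; rewrite !mxE mulrC -numEsg.
  rewrite -[LHS]mul1mx -[RHS]mul1mx -VN -2!(mulmxA V1); congr (V1 *m _).
  rewrite !mulmxA -[N1 *m imul_mx]imul_mx_scale -[imul_mx *m N1 *m E1]mulmxA NE.
  rewrite imul_mx_scale plane_scale_imul_intertwine plane_scale_norm_intertwine.
  rewrite -(NE s2) -!mulmxA; congr (Phi *m (N2 *m _)).
  by rewrite imul_mx_scale.
rewrite !mulmxA (imul_mx_reflect e1K) -(mulmxA K1) -(mulmxA K1) EPhi.
rewrite -!mulmxA; congr (K1 *m (Phi *m _)).
rewrite -(plane_reflect_scale e2 e2) mulmxA (imul_mx_reflect e2K) -mulmxA.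
by rewrite plane_scale_mxM plane_scale_mx1 // mulmx1.
Qed.

End Intertwiner.
End CoordinatePlanes.

Lemma char_poly_conj (F : fieldType) (m : nat) (A B Phi : 'M[F]_m) :
  A *m Phi = Phi *m B -> Phi \in unitmx -> char_poly A = char_poly B.
Proof.
move=> APhi Phi_unit.
have E : char_poly_mx A *m map_mx polyC Phi =
         map_mx polyC Phi *m char_poly_mx B.
  by rewrite mulmxBl mulmxBr -!map_mxM APhi scalar_mxC.
have := congr1 determinant E; rewrite !det_mulmx mulrC; apply: mulfI.
by rewrite det_map_mx polyC_eq0; move: Phi_unit; rewrite unitmxE unitfE.
Qed.

Lemma char_poly_plane_scale (R : rcfType) (n : nat) (c : 'I_n -> R) :
  char_poly (plane_scale_mx c) = (\prod_j ('X - (c j)%:P)) ^+ 2.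
Proof.
rewrite /char_poly /char_poly_mx /plane_scale_mx.
have -> : 'X%:M - map_mx polyC (diag_mx (mxvec (\matrix_(j < n, s < 2) c j))) =
    diag_mx (mxvec (\matrix_(j < n, s < 2) ('X - (c j)%:P))).
  apply/matrixP => i k; rewrite !mxE.
  have [_|ik] := eqVneq i k; last by rewrite !mulr0n subr0.
  rewrite !mulr1n; by case/mxvec_indexP: i => j t; rewrite !mxvecE !mxE.
rewrite det_diag_mxvec -prodrXl; apply: eq_bigr => j _.
by rewrite !big_ord_recl big_ord0 !mxE mulr1 expr2.
Qed.

Lemma plane_scale_perm (R : rcfType) (n : nat) (c1 c2 : 'I_n -> R)
    (Phi : 'M[R]_(n * 2)) :
  plane_scale_mx c1 *m Phi = Phi *m plane_scale_mx c2 -> Phi \in unitmx ->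
  exists s : 'S_n, forall i, c2 (s i) = c1 i.
Proof.
move=> cPhi /(char_poly_conj cPhi); rewrite !char_poly_plane_scale => /eqP.
rewrite eqf_sqr => /orP[|] /eqP cc.
  have /tuple_permP [s E] : perm_eq [tuple c1 i | i < n] [tuple c2 i | i < n].
    apply: prod_XsubC_eq; rewrite !big_tuple.
    under eq_bigr do rewrite tnth_mktuple.
    by rewrite cc; apply: eq_bigr => j _; rewrite tnth_mktuple.
  exists s => i; have := congr1 (fun t => tnth t i) (val_inj E).
  by rewrite !tnth_mktuple.
have := congr1 (fun p : {poly R} => lead_coef p) cc.
rewrite lead_coefN !(monicP (monic_prod_XsubC _ _ _)) => /eqP.
by rewrite eq_sym -subr_eq0 -opprD oppr_eq0 -mulr2n pnatr_eq0.
Qed.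

Lemma polynomial_nonroot (R : numDomainType) (p : {poly R}) :
  p != 0 -> exists t : nat, p.[t%:R] != 0.
Proof.
move=> p0; pose rs := [seq t%:R : R | t <- iota 0 (size p)].
have [/(max_poly_roots p0)|] := boolP (all (root p) rs); last first.
  by case/allPn => _ /mapP[t _ ->] tP; exists t.
rewrite size_map size_iota ltnn map_inj_in_uniq ?iota_uniq; last first.
  by move=> t u _ _ /eqP; rewrite eqr_nat => /eqP.
by move=> /(_ isT).
Qed.

Lemma generic_vector (R : realFieldType) (k : nat) (Ls : seq 'rV[int]_k) :
    (forall L, L \in Ls -> L != 0) ->
  exists x : 'rV[R]_k, forall L, L \in Ls ->
    let a := \sum_j (L 0 j)%:~R * x 0 j in a != 0 /\ `|a| < 2^-1.
Proof.
move=> L0.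
pose p (L : 'rV[int]_k) : {poly R} := \sum_(j < k) (L 0 j)%:~R *: 'X^j.
have p0 L : L \in Ls -> p L != 0.
  move=> /L0; apply: contra => /eqP pL; apply/eqP/rowP => j; rewrite mxE.
  have := congr1 (fun q : {poly R} => q`_j) pL.
  rewrite coef_sum coef0 (bigD1 j) //= coefZ coefXn eqxx mulr1 big1 ?addr0.
    by move/eqP; rewrite intr_eq0 => /eqP.
  by move=> i ij; rewrite coefZ coefXn eq_sym [_ == _](negPf ij) mulr0.
have [t tP] : exists t : nat, (\prod_(L <- Ls) p L).[t%:R] != 0.
  by apply: polynomial_nonroot; rewrite prodf_seq_neq0; apply/allP => L /p0 ->.
pose y : 'rV[R]_k := \row_j t%:R ^+ j.
pose f (L : 'rV[int]_k) := \sum_j (L 0 j)%:~R * y 0 j.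
have fE L : f L = (p L).[t%:R].
  by rewrite horner_sum; apply: eq_bigr => j _; rewrite hornerZ hornerXn mxE.
pose B := 1 + 2 * \sum_(L <- Ls) `|f L|.
have B0 : 0 < B.
  by rewrite ltr_wpDr ?ltr01 // mulr_ge0 ?ler0n // sumr_ge0.
exists (B^-1 *: y) => L LLs.
have -> : \sum_j (L 0 j)%:~R * (B^-1 *: y) 0 j = B^-1 * f L.
  rewrite /f mulr_sumr; apply: eq_bigr => j _.
  by rewrite [X in _ * X = _]mxE mulrCA.
split.
  apply: mulf_neq0; first by rewrite invr_eq0 gt_eqF.
  rewrite fE; move: tP; rewrite horner_prod prodf_seq_neq0.
  by move=> /allP/(_ _ LLs).
rewrite normrM normfV (gtr0_norm B0) mulrC ltr_pdivrMr //.
rewrite -ltr_pdivrMl ?invr_gt0 ?ltr0n // invrK /B.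
rewrite ltr_pwDl // ler_pM2l ?ltr0n // (perm_big _ (perm_to_rem LLs)) big_cons.
by rewrite lerDl sumr_ge0.
Qed.

(** * Frames and orientations *)

Lemma mul_matrix_rows (R : nzRingType) (m p q : nat)
    (f : {linear 'rV[R]_m -> 'rV[R]_p}) (u : 'rV[R]_q) (e : 'M[R]_(q, m)) :
  u *m (\matrix_j f (row j e)) = f (u *m e).
Proof.
rewrite mulmx_sum_row (mulmx_sum_row u e) linear_sum; apply: eq_bigr => j _.
by rewrite linearZ rowK.
Qed.

Section RealCoords.
Variables (R : realType).

Definition of_real_coords (r : nat) (v : 'rV[R]_(r * 2)) : 'rV[R[i]]_r :=
  \row_j Complex (vec_mx v j 0) (vec_mx v j 1).

Lemma real_coordsK r : cancel (@real_coords R r) (@of_real_coords r).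
Proof.
move=> z; apply/rowP => j; rewrite mxE /real_coords mxvecK !mxE /=.
by case: (z 0 j).
Qed.

Lemma real_coordsP r (a : R) (y z : 'rV[R[i]]_r) :
  real_coords (real_complex R a *: y + z) = a *: real_coords y + real_coords z.
Proof.
rewrite /real_coords -linearP; congr mxvec.
apply/matrixP => j s; rewrite !mxE; case: (y 0 j) (z 0 j) => [y1 y2] [z1 z2] /=.
by case: (s == 0); rewrite mul0r ?subr0 ?addr0.
Qed.

Lemma real_coords_rotation r (c s : 'I_r -> R) (z : 'rV[R[i]]_r) :
  real_coords (\row_j (Complex (c j) (s j) * z 0 j)) =
  real_coords z *m rotation_mx c s.
Proof.
rewrite /rotation_mx mulmxDr mulmxA !mxvec_mul_diag mxvec_imul -linearD.
congr mxvec; apply/matrixP => j t; rewrite !mxE /=.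
case: (z 0 j) => a b /=; move: t; apply: ord2P; rewrite /=.
- by rewrite mulrC [b * _]mulrC.
- by rewrite mulrC [a * _]mulrC.
Qed.

Lemma real_coords_imul r (z : 'rV[R[i]]_r) :
  real_coords ('i%C *: z) = real_coords z *m imul_mx R r.
Proof.
have -> : 'i%C *: z = \row_j (Complex (0 : R) 1 * z 0 j).
  by apply/rowP => j; rewrite !mxE.
rewrite (real_coords_rotation (fun=> 0) (fun=> 1)) /rotation_mx.
rewrite (@plane_scale_mx1 _ _ (fun=> 1)) // mul1mx.
by rewrite [plane_scale_mx _](_ : _ = 0) ?add0r // /plane_scale_mx;
  apply/matrixP => i k; rewrite !mxE; case/mxvec_indexP: i => j t;
  rewrite mxvecE mxE mul0rn.
Qed.

Definition split_coords n d (w : 'rV[R[i]]_n * 'rV[R[i]]_d) :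
  'rV[R]_(n * 2 + d * 2) := row_mx (real_coords w.1) (real_coords w.2).

Definition of_split_coords n d (v : 'rV[R]_(n * 2 + d * 2)) :
    'rV[R[i]]_n * 'rV[R[i]]_d :=
  (of_real_coords (lsubmx v), of_real_coords (rsubmx v)).

Lemma split_coordsK n d : cancel (@split_coords n d) (@of_split_coords n d).
Proof.
by case=> y z; rewrite /of_split_coords row_mxKl row_mxKr !real_coordsK.
Qed.

Lemma split_coordsP n d (a : R) (y z : 'rV[R[i]]_n * 'rV[R[i]]_d) :
  split_coords (real_complex R a *: y + z) =
  a *: split_coords y + split_coords z.
Proof.
by rewrite /split_coords !real_coordsP scale_row_mx add_row_mx.
Qed.

Definition split_imul_mx n d : 'M[R]_(n * 2 + d * 2) :=
  block_mx (imul_mx R n) 0 0 (imul_mx R d).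

Lemma split_imul_mxK n d :
  split_imul_mx n d *m split_imul_mx n d = - 1%:M.
Proof.
rewrite mulmx_block !(mulmx0, mul0mx, addr0, add0r) !imul_mxK.
by rewrite scalar_mx_block opp_block_mx !oppr0.
Qed.

Lemma split_coords_imul n d (z : 'rV[R[i]]_n * 'rV[R[i]]_d) :
  split_coords ('i%C *: z) = split_coords z *m split_imul_mx n d.
Proof.
rewrite /split_coords mul_row_block !mulmx0 addr0 add0r.
by rewrite -!real_coords_imul.
Qed.

End RealCoords.

Section Frames.
Variables (R : realType) (n d : nat) (M : manifold R (n * 2)).
Variables (c : stable_complex_structure M d) (q : M).
Implicit Types (e : 'M[R]_(n * 2)).

Definition frame_coords (psi : scs_bundle c q -> 'rV[R[i]]_n * 'rV[R[i]]_d)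
    (w : 'rV[R]_(n * 2) * 'rV[R]_(d * 2)) : 'rV[R]_(n * 2 + d * 2) :=
  split_coords (psi (ctau c q w)).

Variable psi : {linear scs_bundle c q -> ('rV[R[i]]_n * 'rV[R[i]]_d)%type}.

Lemma frame_coordsP (a : R) w w' :
  frame_coords psi (a *: w + w') =
  a *: frame_coords psi w + frame_coords psi w'.
Proof. by rewrite /frame_coords linearP /= linearP split_coordsP. Qed.

Lemma frame_coords0 : frame_coords psi 0 = 0.
Proof.
by have := frame_coordsP (-1) 0 0; rewrite scaler0 addr0 scaleN1r addNr.
Qed.

Lemma mul_stable_frame_mx (u : 'rV[R]_(n * 2)) (y : 'rV[R]_(d * 2)) e :
  row_mx u y *m stable_frame_mx psi e = frame_coords psi (u *m e, y).
Proof.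
have lf : linear (fun v : 'rV[R]_(n * 2) => frame_coords psi (v, 0)).
  move=> a v v'; rewrite -frame_coordsP; congr frame_coords.
  by rewrite [RHS](_ : _ = (a *: v + v', a *: 0 + 0)) // scaler0 addr0.
have lg : linear (fun v : 'rV[R]_(d * 2) => frame_coords psi (0, v)).
  move=> a v v'; rewrite -frame_coordsP; congr frame_coords.
  by rewrite [RHS](_ : _ = (a *: 0 + 0, a *: v + v')) // scaler0 addr0.
pose f : {linear 'rV[R]_(n * 2) -> 'rV[R]_(n * 2 + d * 2)} :=
  HB.pack (fun v : 'rV[R]_(n * 2) => frame_coords psi (v, 0))
   (GRing.isLinear.Build _ _ _ _ _ lf).
pose g : {linear 'rV[R]_(d * 2) -> 'rV[R]_(n * 2 + d * 2)} :=
  HB.pack (fun v : 'rV[R]_(d * 2) => frame_coords psi (0, v))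
   (GRing.isLinear.Build _ _ _ _ _ lg).
have -> : (u *m e, y) = 1 *: (u *m e, 0) + (0, y).
  rewrite [RHS](_ : _ = (1 *: (u *m e) + 0, 1 *: 0 + y)) //.
  by rewrite !scale1r addr0 add0r.
rewrite frame_coordsP scale1r mul_row_col.
congr (_ + _); first exact: (mul_matrix_rows f).
rewrite -[X in frame_coords psi (0, X)]mulmx1 -[RHS](mul_matrix_rows g).
by congr (_ *m _); apply/matrixP => i j; rewrite !mxE row1.
Qed.

Lemma det_stable_frame_mx e :
  \det (stable_frame_mx psi e) = \det e * \det (stable_frame_mx psi 1%:M).
Proof.
have -> : stable_frame_mx psi e =
    block_mx e 0 0 1%:M *m stable_frame_mx psi 1%:M.
  apply: mulmx_row_inj => v; rewrite -[v]hsubmxK mulmxA mul_row_block.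
  by rewrite !mul_stable_frame_mx !mulmx0 !mulmx1 addr0 add0r.
by rewrite det_mulmx det_lblock det1 mulr1.
Qed.

Hypothesis psi_bij : bijective psi.

Lemma stable_frame_unit e : e \in unitmx -> stable_frame_mx psi e \in unitmx.
Proof.
move=> eU; rewrite -row_free_unit; apply: inj_row_free => v.
rewrite -[v]hsubmxK mul_stable_frame_mx -frame_coords0.
move/(can_inj (@split_coordsK _ _ _))/(bij_inj psi_bij).
move/(can_inj (@ctauK _ _ _ _ c q)) => [ue re].
rewrite -[lsubmx v](mulmxK eU) ue re mul0mx frame_coords0; exact: row_mx0.
Qed.

End Frames.

Section Orientation.
Variables (R : realType) (n : nat) (M : manifold R (n * 2)).

Lemma det_stable_frame_gt0 d (c : stable_complex_structure M d) (q : M)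
    (psi psi' : {linear scs_bundle c q -> ('rV[R[i]]_n * 'rV[R[i]]_d)%type})
    (e : 'M[R]_(n * 2)) :
  bijective psi -> bijective psi' -> e \in unitmx ->
  0 < \det (stable_frame_mx psi e) * \det (stable_frame_mx psi' e).
Proof.
move=> psi_bij psi'_bij eU.
have FU := stable_frame_unit psi_bij eU.
have FU' := stable_frame_unit psi'_bij eU.
set F := stable_frame_mx psi e in FU *.
set F' := stable_frame_mx psi' e in FU' *.
have dF : \det F != 0 by move: FU; rewrite unitmxE unitfE.
have dF' : \det F' != 0 by move: FU'; rewrite unitmxE unitfE.
have [N FN] : exists N, F *m N = F' by exists (invmx F *m F'); rewrite mulKVmx.
rewrite lt0r mulf_neq0 //= -FN det_mulmx mulrA mulr_ge0 -?expr2 ?sqr_ge0 //.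
apply: (det_comm_complex_structure_ge0 (@split_imul_mxK _ _ _)).
apply: (can_inj (mulKmx FU)); rewrite !mulmxA FN.
apply: mulmx_row_inj => v; rewrite !mulmxA -[v]hsubmxK !mul_stable_frame_mx.
rewrite /frame_coords -!split_coords_imul.
have iP (f : {linear scs_bundle c q -> ('rV[R[i]]_n * 'rV[R[i]]_d)%type}) z :
    'i%C *: f z = f ('i%C *: z) by rewrite linearZ.
rewrite !iP; move: ('i%C *: _) => z.
rewrite -(ctauVK z); case: (ctauV z) => u y.
have := mul_stable_frame_mx psi (u *m invmx e) y e; rewrite /frame_coords.
rewrite mulmxKV // => <-; rewrite -mulmxA -/F FN mul_stable_frame_mx.
by rewrite mulmxKV.
Qed.

Lemma positive_basisE d (c : stable_complex_structure M d) (q : M)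
    (psi : {linear scs_bundle c q -> ('rV[R[i]]_n * 'rV[R[i]]_d)%type})
    (e : 'M[R]_(n * 2)) :
  bijective psi -> e \in unitmx ->
  positive_basis c q e <-> 0 < \det (stable_frame_mx psi e).
Proof.
move=> psi_bij eU; split=> [[psi' [psi'_bij]]|]; last by exists psi.
move=> h; have := det_stable_frame_gt0 psi_bij psi'_bij eU.
by rewrite pmulr_lgt0.
Qed.

Lemma same_orientationE d1 d2 (c1 : stable_complex_structure M d1)
    (c2 : stable_complex_structure M d2) (q : M)
    (psi1 : {linear scs_bundle c1 q -> ('rV[R[i]]_n * 'rV[R[i]]_d1)%type})
    (psi2 : {linear scs_bundle c2 q -> ('rV[R[i]]_n * 'rV[R[i]]_d2)%type})
    (e : 'M[R]_(n * 2)) :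
  bijective psi1 -> bijective psi2 -> e \in unitmx ->
  same_orientation_at c1 c2 q <->
  0 < \det (stable_frame_mx psi1 e) * \det (stable_frame_mx psi2 e).
Proof.
move=> psi1_bij psi2_bij eU.
have F0 d (c : stable_complex_structure M d)
    (psi : {linear scs_bundle c q -> ('rV[R[i]]_n * 'rV[R[i]]_d)%type}) e' :
    bijective psi -> e' \in unitmx -> \det (stable_frame_mx psi e') != 0.
  by move=> ? ?; rewrite -unitfE -unitmxE stable_frame_unit.
split=> [/(_ e eU)|].
  move: (F0 _ _ _ _ psi1_bij eU) (F0 _ _ _ _ psi2_bij eU).
  rewrite (positive_basisE psi1_bij eU) (positive_basisE psi2_bij eU).
  rewrite !neq_lt => /orP[a|a] /orP[b|b] [ab ba].
  - by rewrite nmulr_rgt0.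
  - by have := lt_trans a (ba b); rewrite ltxx.
  - by have := lt_trans b (ab a); rewrite ltxx.
  - by rewrite mulr_gt0.
move=> e12 e' e'U.
rewrite (positive_basisE psi1_bij e'U) (positive_basisE psi2_bij e'U).
have : 0 < \det (stable_frame_mx psi1 e') * \det (stable_frame_mx psi2 e').
  have sq (x a b : R) : x != 0 -> (0 < x * a * (x * b)) = (0 < a * b).
    by move=> x0; rewrite mulrACA -expr2 pmulr_rgt0 // lt0r sqrf_eq0 x0 sqr_ge0.
  have det0 (a : 'M[R]_(n * 2)) : a \in unitmx -> \det a != 0.
    by rewrite unitmxE unitfE.
  move: e12; rewrite !(det_stable_frame_mx _ e) !(det_stable_frame_mx _ e').
  by rewrite !sq ?det0.
by move=> h; split=> h'; move: h; rewrite ?(pmulr_rgt0 _ h') ?(pmulr_lgt0 _ h').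
Qed.

End Orientation.

Local Open Scope classical_set_scope.

Lemma diff_local_inverse (R : realType) (V W : normedModType R)
    (f : V -> W) (g : W -> V) (x : V) :
    differentiable f x -> differentiable g (f x) ->
    (\forall y \near x, g (f y) = y) ->
  cancel ('d f x) ('d g (f x)).
Proof.
move=> df dg gf v.
have : 'd (g \o f) x = idfun :> (V -> V).
  apply: diff_unique; first by move=> y; exact: cvg_id.
  apply/eqaddoP => _/posnumP[eps].
  have gfx : g (f x) = x by exact: (nbhs_singleton gf).
  move/nbhs0P: gf; apply: filterS => h gf.
  rewrite -[X in `|X|]/(g (f (h + x)) - (g (f x) + h)) addrC.
  by rewrite [h + x]addrC gf gfx addNr normr0 mulr_ge0.
by rewrite diff_comp // => /(congr1 (fun h => h v)).
Qed.

Lemma det_continuous (R : realType) (T : topologicalType) (m : nat)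
    (F : T -> 'M[R]_m) (x : T) :
  (forall i j, continuous_at x (fun q => F q i j)) ->
  continuous_at x (fun q => \det (F q)).
Proof.
move=> cF; apply: cvg_big => [|s _]; first exact: add_continuous.
apply: cvgM; first exact: cvg_cst.
by apply: cvg_big => [|i _]; [exact: mul_continuous|exact: cF].
Qed.

Lemma connected_component_clopen (T : topologicalType) (A : set T) (p : T) :
  A p -> (forall q, \forall r \near q, A r <-> A q) ->
  connected_component setT p `<=` A.
Proof.
move=> Ap locA q pq.
have oA : open A.
  by rewrite openE => r Ar; apply: filterS (locA r) => r' [_]; exact.
have cA : closed A.
  rewrite -openC openE => r nAr; apply: filterS (locA r) => r' [h _] /h.
  exact: nAr.
have E : connected_component setT p `&` A = connected_component setT p.
  apply: (@component_connected T setT p).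
  - by exists p; split => //; exact: connected_component_refl.
  - by exists A.
  - by exists A.
by move: pq; rewrite -E => -[].
Qed.

Section LocalFrames.
Variables (R : realType) (n : nat) (M : manifold R (n * 2)).

Lemma chart_tangent_inj (b : chart R M (n * 2)) (q : M) :
  atlas b -> chart_dom b q -> injective (chart_tangent b q).
Proof.
move=> ab bq; pose a := chart_at q.
have aa : atlas a := chart_at_atlas q.
have aq : chart_dom a q := chart_at_dom q.
pose g (y : 'rV[R]_(n * 2)) := b (chart_inv a y).
have smooth1 (a1 b1 : chart R M (n * 2)) : atlas a1 -> atlas b1 ->
    chart_dom a1 q -> chart_dom b1 q ->
    differentiable (fun y => b1 (chart_inv a1 y)) (a1 q).
  by move=> ? ? ? ?; apply: (atlas_smooth _ _ 1%N).1 => //; exists q.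
apply: (can_inj (g := 'd g (a q))).
rewrite -[a q](_ : a (chart_inv b (b q)) = _); last by rewrite chart_mapK.
apply: (@diff_local_inverse _ _ _ (fun y => a (chart_inv b y)) g (b q)).
- exact: smooth1.
- by rewrite chart_mapK //; exact: smooth1.
have nb : nbhs (b q) (b @` chart_dom b).
  by apply: open_nbhs_nbhs; split; [exact: chart_img_open|exists q].
have na : nbhs (b q) (chart_inv b @^-1` chart_dom a).
  have := @chart_inv_continuous _ _ _ b.
  rewrite continuous_open_subspace; last exact: chart_img_open.
  move=> /(_ (b q)); apply; first by apply/mem_set; exists q.
  rewrite chart_mapK //; apply: open_nbhs_nbhs; split=> //.
  exact: chart_dom_open.
apply: filterS2 nb na => _ [r br <-] /=; rewrite chart_mapK // => ar.
by rewrite /g chart_mapK.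
Qed.

Definition chart_frame (b : chart R M (n * 2)) (q : M) : 'M[R]_(n * 2) :=
  \matrix_j chart_tangent b q (row j 1%:M).

Lemma chart_frame_unit (b : chart R M (n * 2)) (q : M) :
  atlas b -> chart_dom b q -> chart_frame b q \in unitmx.
Proof.
move=> ab bq; rewrite -row_free_unit; apply: inj_row_free => v.
pose t : {linear 'rV[R]_(n * 2) -> 'rV[R]_(n * 2)} :=
  'd (fun y : 'rV[R]_(n * 2) => chart_at q (chart_inv b y)) (b q).
rewrite (mul_matrix_rows t) mulmx1 -[RHS](linear0 t).
exact: (chart_tangent_inj ab bq).
Qed.

Variables (d : nat) (c : stable_complex_structure M d).

Definition triv_split (i : triv_index (scs_bundle c)) (q : M)
    (z : scs_bundle c q) : 'rV[R[i]]_n * 'rV[R[i]]_d :=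
  (lsubmx (triv i q z), rsubmx (triv i q z)).

Lemma triv_split_is_linear i q : linear (@triv_split i q).
Proof. by move=> a y z; rewrite /triv_split !linearP. Qed.

HB.instance Definition _ i q := GRing.isLinear.Build R[i] (scs_bundle c q)
  ('rV[R[i]]_n * 'rV[R[i]]_d)%type _ (@triv_split i q)
  (@triv_split_is_linear i q).

Lemma triv_split_bij i q : triv_dom i q -> bijective (@triv_split i q).
Proof.
move=> iq; exists (fun w => trivV i q (row_mx w.1 w.2)) => z.
  by rewrite /= hsubmxK trivK.
by rewrite /triv_split trivVK // row_mxKl row_mxKr; case: z.
Qed.

Lemma split_coords_entry (l : 'I_(n * 2 + d * 2)) :
  exists k, forall z : 'rV[R[i]]_(n + d),
    split_coords (lsubmx z, rsubmx z) 0 l = real_coords z 0 k.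
Proof.
rewrite -(fintype.splitK l).
case: (fintype.split l) => /= h; case/mxvec_indexP: h => j s.
  exists (mxvec_index (lshift d j) s) => z.
  by rewrite row_mxEl /real_coords !mxvecE !mxE.
exists (mxvec_index (rshift n j) s) => z.
by rewrite row_mxEr /real_coords !mxvecE !mxE.
Qed.

Lemma local_frame_continuous (b : chart R M (n * 2))
    (i : triv_index (scs_bundle c)) (q : M) :
    atlas b -> chart_dom b q -> triv_dom i q ->
  continuous_at q (fun r =>
    \det (stable_frame_mx (@triv_split i r) (chart_frame b r))).
Proof.
move=> ab bq iq; apply: det_continuous => k l.
have ctn u y : continuous_at q (fun r => split_coords
    (triv_split i (ctau c r (chart_tangent b r u, y))) 0 l).
  have [h hE] := split_coords_entry l.
  rewrite /triv_split; under eq_fun do rewrite hE.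
  have := @ctau_continuous _ _ _ _ c b i u y ab.
  rewrite continuous_open_subspace; last first.
    by apply: openI; [exact: chart_dom_open|exact: triv_dom_open].
  move=> /(_ q (mem_set (conj bq iq))) ct.
  exact: (continuous_comp ct (@coord_continuous _ _ _ 0 h _)).
rewrite -(fintype.splitK k); case: (fintype.split k) => /= j.
  under eq_fun do rewrite col_mxEu mxE rowK; exact: ctn.
have -> : (fun r => stable_frame_mx (@triv_split i r) (chart_frame b r)
             (rshift (n * 2) j) l) =
    (fun r => split_coords
      (triv_split i (ctau c r (chart_tangent b r 0, delta_mx 0 j))) 0 l).
  by apply/funext => r; rewrite col_mxEd mxE /chart_tangent linear0.
exact: ctn.
Qed.

End LocalFrames.

Lemma same_orientation_locally_constant (R : realType) (n d1 d2 : nat)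
    (M : manifold R (n * 2)) (c1 : stable_complex_structure M d1)
    (c2 : stable_complex_structure M d2) (q : M) :
  \forall r \near q,
    same_orientation_at c1 c2 r <-> same_orientation_at c1 c2 q.
Proof.
pose b := chart_at q.
have ab : atlas b := chart_at_atlas q.
have bq : chart_dom b q := chart_at_dom q.
have [i1 iq1] := @triv_cover _ _ _ (scs_bundle c1) q.
have [i2 iq2] := @triv_cover _ _ _ (scs_bundle c2) q.
pose D r :=
  \det (stable_frame_mx (@triv_split _ _ _ _ c1 i1 r) (chart_frame b r)) *
  \det (stable_frame_mx (@triv_split _ _ _ _ c2 i2 r) (chart_frame b r)).
have sameE r : chart_dom b r -> triv_dom i1 r -> triv_dom i2 r ->
    same_orientation_at c1 c2 r <-> 0 < D r.
  move=> br ir1 ir2; apply: same_orientationE.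
  - exact: triv_split_bij.
  - exact: triv_split_bij.
  - exact: chart_frame_unit.
have D0 : D q != 0.
  rewrite /D mulf_neq0 // -unitfE -unitmxE; apply: stable_frame_unit.
  - exact: triv_split_bij.
  - exact: chart_frame_unit.
  - exact: triv_split_bij.
  - exact: chart_frame_unit.
have cD : D r @[r --> q] --> D q by apply: cvgM; exact: local_frame_continuous.
clearbody D.
have nb : \forall r \near q, chart_dom b r.
  by apply: open_nbhs_nbhs; split => //; exact: chart_dom_open.
have n1 : \forall r \near q, triv_dom i1 r.
  by apply: open_nbhs_nbhs; split => //; exact: triv_dom_open.
have n2 : \forall r \near q, triv_dom i2 r.
  by apply: open_nbhs_nbhs; split => //; exact: triv_dom_open.
have nD : \forall r \near q, (0 < D r) = (0 < D q).
  move: D0; rewrite neq_lt => /orP[Dn|Dp].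
    by apply: filterS (cvgr_lt _ cD _ Dn) => r Drn;
      rewrite [LHS]lt_gtF // [RHS]lt_gtF.
  by apply: filterS (cvgr_gt _ cD _ Dp) => r Drp; rewrite Dp Drp.
apply: filterS2 (filterI nb n1) (filterI n2 nD) => r [br ir1] [ir2 DrE].
by rewrite sameE // sameE // DrE.
Qed.

Lemma same_orientation_component (R : realType) (n d1 d2 : nat)
    (M : manifold R (n * 2)) (c1 : stable_complex_structure M d1)
    (c2 : stable_complex_structure M d2) (p q : M) :
  same_orientation_at c1 c2 p -> connected_component setT p q ->
  same_orientation_at c1 c2 q.
Proof.
move=> cp pq; pose A := [set r : M | same_orientation_at c1 c2 r].
apply: (@connected_component_clopen M A p) pq => // r.
exact: same_orientation_locally_constant.
Qed.

Local Close Scope classical_set_scope.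

(** * The isotropy representation *)

Section FixedPoint.
Variables (R : realType) (k n : nat) (M : manifold R (n * 2)).
Variables (theta : torus_action k M) (p : M) (hp : fixed_points theta p).

Definition isotropy_mx (x : 'rV[R]_k) : 'M[R]_(n * 2) :=
  \matrix_j (tangent_map (theta (torus_exp x)) (row j 1%:M : tangent p)
             : 'rV_(n * 2)).

Lemma ctau_transport d (c : stable_complex_structure M d) (q : M) (e : q = p)
    (u : 'rV[R]_(n * 2)) (y : 'rV[R]_(d * 2)) :
  eq_rect q (fun r : M => scs_bundle c r : Type) (ctau c q (u, y)) p e =
  ctau c p (u, y).
Proof. by case: p / e. Qed.

Lemma fixed_rep_ctau d (c : stable_complex_structure M d) (x : 'rV[R]_k)
    (u : 'rV[R]_(n * 2)) (y : 'rV[R]_(d * 2)) :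
  fixed_rep hp (torus_exp x) (ctau c p (u, y)) =
  ctau c p (u *m isotropy_mx x, y).
Proof.
rewrite /fixed_rep /bundle_rep ctau_transport ctauK /=.
congr (ctau c p (_, y)).
rewrite (mul_matrix_rows ('d (fun z : 'rV[R]_(n * 2) =>
  chart_at (theta (torus_exp x) p)
    (theta (torus_exp x) (chart_inv (chart_at p) z))) (chart_at p p))).
by rewrite mulmx1.
Qed.

Definition angle (L : 'rV[int]_k) (x : 'rV[R]_k) : R := 2 * pi * pairing L x.

Section Splitting.
Variables (d : nat) (c : stable_complex_structure M d).
Variable S : weight_splitting c hp.

Let F := stable_frame_mx (split_iso S) 1%:M.

Definition weight_rotation (x : 'rV[R]_k) : 'M[R]_(n * 2) :=
  rotation_mx (fun j => cos (angle (weight S j) x))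
              (fun j => sin (angle (weight S j) x)).

Definition tangent_frame_mx : 'M[R]_(n * 2) := ulsubmx F.

Lemma frame_isotropy (x : 'rV[R]_k) :
  block_mx (isotropy_mx x) 0 0 1%:M *m F =
  F *m block_mx (weight_rotation x) 0 0 1%:M.
Proof.
apply: mulmx_row_inj => v; rewrite !mulmxA -[v]hsubmxK mul_row_block.
rewrite !mulmx0 mulmx1 addr0 add0r !mul_stable_frame_mx !mulmx1.
rewrite /frame_coords -fixed_rep_ctau split_rep /split_coords /=.
by rewrite mul_row_block !mulmx0 mulmx1 addr0 add0r -real_coords_rotation.
Qed.

Lemma tangent_frame_isotropy (x : 'rV[R]_k) :
  isotropy_mx x *m tangent_frame_mx = tangent_frame_mx *m weight_rotation x.
Proof.
have := frame_isotropy x.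
rewrite -[F]submxK !mulmx_block => /eq_block_mx[+ _ _ _].
by rewrite !(mul0mx, mulmx0, addr0).
Qed.

Variable x : 'rV[R]_k.
Hypothesis sin_neq0 : forall j, sin (angle (weight S j) x) != 0.

(* The trivial summand of T(+)R^(2d) is mapped to the trivial summand C^d. *)
Lemma dlsubmx_frame : dlsubmx F = 0.
Proof.
apply: (@rotation_mx_fix _ _ _ (fun j => cos (angle (weight S j) x))
          (fun j => sin (angle (weight S j) x))) => // [j|].
  exact: cos2Dsin2.
have := frame_isotropy x.
rewrite -[F]submxK !mulmx_block => /eq_block_mx[_ _ + _].
by rewrite !(mul0mx, mulmx0, addr0, add0r, mul1mx) block_mxKdl => {2}->.
Qed.

Lemma det_frame_neq0 : \det F != 0.
Proof.
rewrite -unitfE -unitmxE; apply: stable_frame_unit; last exact: unitmx1.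
exact: split_iso_bij.
Qed.

Lemma tangent_frame_unit : tangent_frame_mx \in unitmx.
Proof.
have := det_frame_neq0; rewrite -[F]submxK dlsubmx_frame det_ublock mulf_eq0.
by rewrite negb_or => /andP[+ _]; rewrite unitmxE unitfE.
Qed.

Lemma fixed_point_signE :
  (fixed_point_sign S)%:~R = Num.sg (\det F * \det tangent_frame_mx) :> R.
Proof.
have F0 := det_frame_neq0.
have G0 : \det tangent_frame_mx != 0.
  by have := tangent_frame_unit; rewrite unitmxE unitfE.
have tE (e : 'M[R]_(n * 2)) :
    \matrix_(j < n * 2) real_coords (split_iso S (ctau c p (row j e, 0))).1 =
    e *m tangent_frame_mx.
  apply/row_matrixP => j; rewrite rowK row_mul /tangent_frame_mx.
  have := mul_stable_frame_mx (split_iso S) (row j e) 0 1%:M.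
  rewrite -/F -[F in LHS]submxK mul_row_block !mul0mx !addr0 mulmx1.
  by move=> /(congr1 lsubmx); rewrite /frame_coords /split_coords !row_mxKl.
have pE : preserves_orientation S <-> 0 < \det F * \det tangent_frame_mx.
  split=> [/(_ _ (unitmx1 _ _))|h e eU].
    rewrite tE mul1mx (positive_basisE (split_iso_bij S) (unitmx1 _ _)) -/F.
    move: F0 G0; rewrite !neq_lt => /orP[a|a] /orP[b|b] [ab ba].
    - by rewrite nmulr_rgt0.
    - by have := lt_trans a (ba b); rewrite ltxx.
    - by have := lt_trans b (ab a); rewrite ltxx.
    - by rewrite mulr_gt0.
  rewrite tE (positive_basisE (split_iso_bij S) eU).
  rewrite det_stable_frame_mx det_mulmx -/F.
  move: F0 h; rewrite neq_lt => /orP[Fn|Fp].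
    by rewrite nmulr_rgt0 // => Gn; rewrite !nmulr_lgt0.
  by rewrite pmulr_rgt0 // => Gp; rewrite !pmulr_lgt0.
rewrite /fixed_point_sign; case: asboolP => [/pE h|npE].
  by rewrite gtr0_sg.
rewrite ltr0_sg // lt_neqAle mulf_neq0 //= leNgt.
by apply/negP => h; apply: npE; apply/pE.
Qed.

End Splitting.
Section TwoSplittings.
Variables (d1 d2 : nat) (c1 : stable_complex_structure M d1)
  (c2 : stable_complex_structure M d2).
Variables (S1 : weight_splitting c1 hp) (S2 : weight_splitting c2 hp).

Lemma pairingD (L L' : 'rV[int]_k) (x : 'rV[R]_k) :
  pairing (L + L') x = pairing L x + pairing L' x.
Proof.
rewrite /pairing -big_split; apply: eq_bigr => j _.
by rewrite mxE rmorphD mulrDl.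
Qed.

Lemma pairingZ (a : int) (L : 'rV[int]_k) (x : 'rV[R]_k) :
  pairing (a *: L) x = a%:~R * pairing L x.
Proof.
rewrite /pairing mulr_sumr; apply: eq_bigr => j _.
by rewrite mxE rmorphM mulrA.
Qed.

Lemma angle_bound (L : 'rV[int]_k) (x : 'rV[R]_k) :
  `|pairing L x| < 2^-1 -> `|angle L x| < pi.
Proof.
move=> h; rewrite /angle normrM ger0_norm ?mulr_ge0 ?pi_ge0 //.
by rewrite -mulrA mulrCA gtr_pMr ?pi_gt0 // mulrC -ltr_pdivlMr // div1r.
Qed.

Lemma generic_angle : exists x : 'rV[R]_k,
  [/\ forall j, sin (angle (weight S1 j) x) != 0,
      forall j, sin (angle (weight S2 j) x) != 0 &
      forall i j, cos (angle (weight S2 j) x) = cos (angle (weight S1 i) x) ->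
        weight S2 j = weight S1 i \/ weight S2 j = - weight S1 i].
Proof.
pose W1 := [seq weight S1 i | i <- enum 'I_n].
pose W2 := [seq weight S2 i | i <- enum 'I_n].
pose Wm := [seq L2 - L1 | L2 <- W2, L1 <- W1].
pose Wp := [seq L2 + L1 | L2 <- W2, L1 <- W1].
have inW1 i : weight S1 i \in W1 by apply: map_f; rewrite mem_enum.
have inW2 i : weight S2 i \in W2 by apply: map_f; rewrite mem_enum.
have inWm i j : weight S2 j - weight S1 i \in Wm.
  by apply/allpairsP; exists (weight S2 j, weight S1 i); split; rewrite /=.
have inWp i j : weight S2 j + weight S1 i \in Wp.
  by apply/allpairsP; exists (weight S2 j, weight S1 i); split; rewrite /=.
have [x xP] := @generic_vector R k
  [seq L <- W1 ++ W2 ++ Wm ++ Wp | L != 0]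
  (fun L => (fun h => (andP (etrans (esym (mem_filter _ _ _)) h)).1)).
have {}xP L : L \in W1 ++ W2 ++ Wm ++ Wp -> L != 0 ->
    pairing L x != 0 /\ `|pairing L x| < 2^-1.
  by move=> LW L0; apply: xP; rewrite mem_filter L0.
have sinP L : L \in W1 ++ W2 ++ Wm ++ Wp -> L != 0 -> sin (angle L x) != 0.
  move=> LW /(xP _ LW)[a0 /angle_bound ab].
  have t0 : angle L x != 0 by rewrite /angle !mulf_neq0 // gt_eqF ?pi_gt0.
  have : sin `|angle L x| != 0 by rewrite gt_eqF // sin_gt0_pi // normr_gt0 t0.
  by case: (ger0P (angle L x)) => _ //; rewrite sinN oppr_eq0.
exists x; split=> [j|j|i j].
- by apply: sinP; rewrite ?weight_neq0 // mem_cat inW1.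
- by apply: sinP; rewrite ?weight_neq0 // !mem_cat inW2 orbT.
rewrite -(cos_norm (angle (weight S2 j) x)) -(cos_norm (angle (weight S1 i) x)).
have b1 : `|angle (weight S1 i) x| < pi.
  by apply/angle_bound/(xP _ _ (weight_neq0 _ _)).2; rewrite mem_cat inW1.
have b2 : `|angle (weight S2 j) x| < pi.
  by apply/angle_bound/(xP _ _ (weight_neq0 _ _)).2; rewrite !mem_cat inW2 orbT.
move=> /cos_inj; rewrite !in_itv /= !normr_ge0 !ltW // => /(_ isT isT).
move=> /eqP; rewrite /angle eqr_norm2 -mulrN.
have pi2 : 2 * pi != 0 :> R by rewrite mulf_neq0 // gt_eqF ?pi_gt0.
move=> /orP[] /eqP /(mulfI pi2) E; [left|right]; apply/eqP.
  rewrite -subr_eq0; apply/negP => /negP L0.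
  have [|+ _] := xP (weight S2 j - weight S1 i) _ L0.
    by rewrite !mem_cat inWm !orbT.
  by rewrite -scaleN1r pairingD pairingZ rmorphN1 mulN1r E subrr eqxx.
rewrite -addr_eq0; apply/negP => /negP L0.
have [|+ _] := xP (weight S2 j + weight S1 i) _ L0.
  by rewrite !mem_cat inWp !orbT.
by rewrite pairingD E addNr eqxx.
Qed.

Lemma intertwinerP (x : 'rV[R]_k) :
    (forall j, sin (angle (weight S1 j) x) != 0) ->
    (forall j, sin (angle (weight S2 j) x) != 0) ->
  let Phi := invmx (tangent_frame_mx S1) *m tangent_frame_mx S2 in
  Phi \in unitmx /\ weight_rotation S1 x *m Phi = Phi *m weight_rotation S2 x.
Proof.
move=> s1 s2 Phi.
have U1 := tangent_frame_unit s1; have U2 := tangent_frame_unit s2.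
split; first by rewrite unitmx_mul unitmx_inv U1.
apply: (can_inj (mulKmx U1)).
rewrite mulmxA -tangent_frame_isotropy -mulmxA /Phi -[in RHS]mulmxA !mulKVmx //.
by rewrite tangent_frame_isotropy.
Qed.

Lemma weights_related_exists :
  exists (s : 'S_n) (a : 'I_n -> int),
    weights_related (weight S1) (weight S2) s a.
Proof.
have [x [s1 s2 cosP]] := generic_angle.
have [PhiU PhiE] := intertwinerP s1 s2.
have cs L : cos (angle L x) ^+ 2 + sin (angle L x) ^+ 2 = 1 by exact: cos2Dsin2.
have [s sP] := plane_scale_perm
  (plane_scale_intertwine (fun=> cs _) (fun=> cs _) PhiE) PhiU.
exists s, (fun i => if weight S2 (s i) == weight S1 i then 1 else -1) => i.
have := cosP _ _ (sP i); case: eqP => [-> _|_ [//|->]].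
  by rewrite scale1r; split => //; left.
by rewrite scaleN1r; split => //; right.
Qed.

Lemma det_tangent_frames (s : 'S_n) (a : 'I_n -> int) :
    weights_related (weight S1) (weight S2) s a ->
  (\prod_i a i)%:~R =
  Num.sg (\det (tangent_frame_mx S1) * \det (tangent_frame_mx S2)) :> R.
Proof.
move=> sa; have [x [s1 s2 _]] := generic_angle.
have [PhiU PhiE] := intertwinerP s1 s2.
have cs L : cos (angle L x) ^+ 2 + sin (angle L x) ^+ 2 = 1 by exact: cos2Dsin2.
have sa2 : \prod_j Num.sg (sin (angle (weight S2 j) x)) =
    (\prod_i a i)%:~R * \prod_j Num.sg (sin (angle (weight S1 j) x)).
  rewrite (reindex_inj (@perm_inj _ s)) /= rmorph_prod -big_split /=.
  apply: eq_bigr => i _; have [ai ->] := sa i.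
  rewrite /angle pairingZ; case: ai => ->; first by rewrite !mul1r.
  by rewrite rmorphN1 mulN1r mulrN sinN sgrN mulN1r.
have a1 : Num.sg ((\prod_i a i)%:~R : R) = (\prod_i a i)%:~R.
  rewrite rmorph_prod (big_morph Num.sg (@sgrM R) (@sgr1 R)).
  apply: eq_bigr => i _.
  by have [[] -> _] := sa i; rewrite ?rmorphN1 ?sgrN sgr1.
have := det_intertwiner_gt0 (fun=> cs _) (fun=> cs _) s1 s2 PhiE PhiU.
rewrite sa2 => /gtr0_sg; rewrite !sgrM a1.
set P := Num.sg (\prod_j _).
have PP : P * P = 1.
  rewrite -expr2 sqr_sg (_ : _ != 0) //; apply/prodf_neq0 => j _.
  by rewrite sgr_eq0.
rewrite (mulrC _ P) mulrACA PP mul1r det_mulmx det_inv !sgrM sgrV.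
set X := Num.sg _ * Num.sg _; set A := _%:~R => XA.
have XX : X * X = 1.
  rewrite /X -sgrM -expr2 sqr_sg mulf_neq0 // -unitfE -unitmxE.
    exact: tangent_frame_unit s1.
  exact: tangent_frame_unit s2.
by transitivity (X * (X * A)); [rewrite mulrA XX mul1r|rewrite XA mulr1].
Qed.

End TwoSplittings.
End FixedPoint.

Lemma orientation_signE (R : realType) (k n d1 d2 : nat)
    (M : manifold R (n * 2)) (theta : torus_action k M) (p : M)
    (hp : fixed_points theta p)
    (c1 : stable_complex_structure M d1) (c2 : stable_complex_structure M d2)
    (S1 : weight_splitting c1 hp) (S2 : weight_splitting c2 hp) :
  (orientation_sign c1 c2 p)%:~R =
  Num.sg (\det (stable_frame_mx (split_iso S1) 1%:M) *
          \det (stable_frame_mx (split_iso S2) 1%:M)) :> R.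
Proof.
have E := same_orientationE (split_iso_bij S1) (split_iso_bij S2)
  (unitmx1 R (n * 2)).
rewrite /orientation_sign; case: asboolP => [same|nsame].
  by rewrite gtr0_sg //; apply/E/same; exact: connected_component_refl.
rewrite ltr0_sg // lt_neqAle mulf_neq0 ?det_frame_neq0 //= leNgt.
apply/negP => /E same; apply: nsame => q; exact: same_orientation_component.
Qed.

Theorem theorem1 (R : realType) (k n d1 d2 : nat) (M : manifold R (n * 2))
  (theta : torus_action k M) (htheta : has_isolated_fixed_points theta)
  (c1 : stable_complex_structure M d1) (c2 : stable_complex_structure M d2)
  (hc1 : equivariant theta c1) (hc2 : equivariant theta c2)
  (p : M) (hp : fixed_points theta p)
  (S1 : weight_splitting c1 hp) (S2 : weight_splitting c2 hp) :
  (exists (s : 'S_n) (a : 'I_n -> int),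
     weights_related (weight S1) (weight S2) s a) /\
  (forall (s : 'S_n) (a : 'I_n -> int),
     weights_related (weight S1) (weight S2) s a ->
     fixed_point_sign S2 =
     orientation_sign c1 c2 p * (\prod_(i < n) a i) * fixed_point_sign S1).
Proof.
split; first exact: weights_related_exists.
move=> s a sa; apply/eqP; rewrite -(eqr_int R); apply/eqP.
have [x [s1 s2 _]] := generic_angle S1 S2.
rewrite !rmorphM /= (fixed_point_signE s1) (fixed_point_signE s2).
rewrite (orientation_signE S1 S2) (det_tangent_frames sa).
have := det_frame_neq0 S1; have := tangent_frame_unit s1.
rewrite unitmxE unitfE -sgr_eq0 => g0; rewrite -sgr_eq0 => f0.
rewrite !sgrM.
have sq (y : R) : Num.sg y != 0 -> Num.sg y * Num.sg y = 1.
  by rewrite sgr_eq0 -expr2 sqr_sg => ->.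
have key (f1 f2 g1 g2 : R) : f1 * f1 = 1 -> g1 * g1 = 1 ->
    f2 * g2 = f1 * f2 * (g1 * g2) * (f1 * g1).
  move=> E1 E2; transitivity ((f1 * f1) * (g1 * g1) * (f2 * g2)); last by ring.
  by rewrite E1 E2 !mul1r.
by apply: key; exact: sq.
Qed.
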